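(* Let $d$ be a positive integer, let $W_1,\dots,W_d$ and $W$ be finite-dimensional complex vector spaces, each of dimension at least two, and let $r$ be a positive integer. (i) If $r$ is not more than the complex generic tensor rank of $W_1\otimes\cdots\otimes W_d$, then the set of rank-$r$ complex tensors $$\{A\in W_1\otimes\cdots\otimes W_d : \operatorname{rank}(A)=r\}$$ is path-connected. (ii) If $r$ is not more than the complex generic symmetric rank of $\mathsf{S}^d(W)$, then the set of symmetric rank-$r$ complex symmetric tensors $$\{A\in \mathsf{S}^d(W) : \operatorname{rank}_{\mathsf{S}}(A)=r\}$$ is path-connected.
   Context: All topological statements use the Euclidean topology. For $A\in W_1\otimes\cdots\otimes W_d$ (complex vector spaces), $\operatorname{rank}(A)$ is the least $r\in\{0,1,2,\dots\}$ such that $A=\sum_{i=1}^r v_{1,i}\otimes\cdots\otimes v_{d,i}$ with $v_{j,i}\in W_j$. $\mathsf{S}^d(W)\subseteq W^{\otimes d}$ is the space of symmetric $d$-tensors; for $A\in\mathsf{S}^d(W)$, $\operatorname{rank}_{\mathsf{S}}(A)$ is the least $r\in\{0,1,2,\dots\}$ such that $A=\sum_{i=1}^r v_i^{\otimes d}$ with $v_i\in W$. The complex generic tensor rank is the smallest $r$ such that the closure of $\{A : \operatorname{rank}(A)\le r\}$ is all of $W_1\otimes\cdots\otimes W_d$. The complex generic symmetric rank is the smallest $r$ such that the closure of $\{A\in\mathsf{S}^d(W):\operatorname{rank}_{\mathsf{S}}(A)\le r\}$ is all of $\mathsf{S}^d(W)$. *)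

(* Defs.v *)
From HB Require Import structures.
From mathcomp Require Import all_boot all_order all_algebra perm.
From mathcomp Require Export complex.
From mathcomp Require Import all_classical all_reals all_analysis.

Set Implicit Arguments.
Unset Strict Implicit.
Unset Printing Implicit Defensive.
Import Order.TTheory GRing.Theory Num.Theory.
Import numFieldNormedType.Exports.

Local Open Scope classical_set_scope.
Local Open Scope ring_scope.
Local Open Scope complex_scope.

Definition is_least (P : nat -> Prop) (r : nat) : Prop :=
  P r /\ forall s, P s -> (r <= s)%N.

(* The Euclidean topology on a finite-dimensional vector space [V] over
   C = R[i], transported from C^n by the coordinates in a basis (any basis
   yields the same topology).  The norm topology of the numeric field R[i] is
   the Euclidean one, and matrices carry the product topology. *)
Definition coordinates (R : realType) (V : vectType R[i]) (v : V) :
    'rV[(R[i] : numFieldType)]_(\dim {:V}) :=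
  \row_k coord (vbasis {:V}) k v.

Definition euclidean (R : realType) (V : vectType R[i]) : topologicalType :=
  initial_topology (@coordinates R V).

Definition path_connected (R : realType) (X : topologicalType) (S : set X) :
    Prop :=
  S !=set0 /\
  forall x y : X, S x -> S y ->
    exists gamma : R -> X,
      [/\ {within `[0, 1], continuous gamma},
          gamma 0 = x, gamma 1 = y & forall t, t \in `[0, 1] -> S (gamma t)].

Section Tensors.
Variables (K : fieldType) (d : nat).

Definition multilinear (W : 'I_d -> vectType K) (U : vectType K)
    (g : (forall j, W j) -> U) : Prop :=
  forall (w : forall j, W j) (j : 'I_d),
    linear (fun x : W j => g (dfwith w j x)).

(* [T], together with [tau : (w_1, ..., w_d) |-> w_1 (x) ... (x) w_d], is the
   tensor product W_1 (x) ... (x) W_d (universal property). *)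
Definition is_tensor_product (W : 'I_d -> vectType K) (T : vectType K)
    (tau : (forall j, W j) -> T) : Prop :=
  multilinear tau /\
  forall (U : vectType K) (g : (forall j, W j) -> U), multilinear g ->
    exists! f : 'Hom(T, U), forall w, f (tau w) = g w.

Section Rank.
Variables (W : 'I_d -> vectType K) (T : vectType K).
Variable tau : (forall j, W j) -> T.

Definition is_rank (A : T) (r : nat) : Prop :=
  is_least (fun s => exists v : 'I_s -> forall j, W j,
    A = \sum_(i < s) tau (v i)) r.

Definition rank_eq_set (r : nat) : set T := [set A | is_rank A r].

Definition rank_le_set (r : nat) : set T :=
  [set A | exists2 s, (s <= r)%N & is_rank A s].

End Rank.

Section SymmetricRank.
Variables (W T : vectType K) (tau : ('I_d -> W) -> T).

(* S^d(W): the tensors fixed by the action of the symmetric group; the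
   endomorphism [f] by which a permutation [s] acts is determined by its
   values on decomposable tensors. *)
Definition symmetric_tensors : set T :=
  [set A | forall s : 'S_d, exists f : 'End(T),
    (forall w : 'I_d -> W, f (tau w) = tau (fun j => w (s j))) /\ f A = A].

Definition is_symrank (A : T) (r : nat) : Prop :=
  is_least (fun s => exists v : 'I_s -> W,
    A = \sum_(i < s) tau (fun=> v i)) r.

Definition symrank_eq_set (r : nat) : set T :=
  [set A | symmetric_tensors A /\ is_symrank A r].

Definition symrank_le_set (r : nat) : set T :=
  [set A | symmetric_tensors A /\ exists2 s, (s <= r)%N & is_symrank A s].

End SymmetricRank.
End Tensors.

Definition is_generic_rank (R : realType) (d : nat) (W : 'I_d -> vectType R[i])
    (T : vectType R[i]) (tau : (forall j, W j) -> T) (g : nat) : Prop :=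
  is_least (fun s => closure (rank_le_set tau s : set (euclidean T)) = setT) g.

(* The closure is taken in the whole tensor space; this is the closure in the
   subspace S^d(W), which is closed. *)
Definition is_generic_symrank (R : realType) (d : nat) (W T : vectType R[i])
    (tau : ('I_d -> W) -> T) (g : nat) : Prop :=
  is_least (fun s => closure (symrank_le_set tau s : set (euclidean T)) =
    (symmetric_tensors tau : set (euclidean T))) g.

(* Main.v *)
(* Let D_s be the set of sums of s decomposable tensors (resp. of s d-th
   powers); it is the image of a polynomial map.  By quantifier elimination,
   D_(r-1) contains the complement in D_g of a proper closed subset, or lies
   in such a subset.  The first case would make D_(r-1) dense, against the
   minimality of g, so some polynomial vanishes on D_(r-1) but not on D_g;
   after a translation it does not vanish on D_r either.  Two tensors of rank
   r lie on a polynomial curve in D_r through a point where this polynomial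
   is nonzero: it has finitely many zeros on the curve, and a path in C from
   0 to 1 can be bent to avoid those other than its ends.  Along this path
   the rank is r, the ends included, even if they lie in the closure of
   D_(r-1). *)
Require Import Defs.
From HB Require Import structures.
From mathcomp Require Import all_boot all_order all_algebra perm.
From mathcomp Require Import closed_field ring.
From mathcomp Require Import all_classical all_reals all_analysis.

Set Implicit Arguments.
Unset Strict Implicit.
Unset Printing Implicit Defensive.
Import Order.TTheory GRing.Theory Num.Theory.
Import numFieldNormedType.Exports.

Local Open Scope classical_set_scope.
Local Open Scope ring_scope.
Local Open Scope complex_scope.

(** * First-order formulas over an algebraically closed field *)

Lemma closed_quantifier_elim (F : closedFieldType) (f : GRing.formula F) :
  GRing.rformula f ->
  exists g, [/\ GRing.qf_form g, GRing.rformula g &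
    forall e, GRing.holds e f <-> GRing.holds e g].
Proof.
move=> rf.
have wf := @ClosedFieldQE.wf_ex_elim F.
have ok := ClosedFieldQE.holds_ex_elim (@solve_monicpoly F).
exists (GRing.quantifier_elim (@ClosedFieldQE.ex_elim F) f).
have /andP[qf ->] := GRing.quantifier_elim_wf wf rf; split=> // e.
rewrite (rwP (GRing.quantifier_elim_rformP wf ok e rf)).
by rewrite -(rwP (GRing.qf_evalP e qf)).
Qed.

Lemma holds_foldr_And (F : unitRingType) (I : eqType) (s : seq I)
    (f : I -> GRing.formula F) (e : seq F) :
  GRing.holds e (foldr (fun i => GRing.And (f i)) GRing.True s) <->
  forall i, i \in s -> GRing.holds e (f i).
Proof.
elim: s => [|i s IHs] /=; first by split.
rewrite IHs; split=> [[fi fs] j|fs]; first by rewrite inE => /predU1P[->|/fs].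
by split=> [|j js]; apply: fs; rewrite inE ?eqxx ?js ?orbT.
Qed.

(** * Polynomial functions of finitely many variables *)

Section PolynomialFunctions.
Variable F : closedFieldType.

(* [f] is a polynomial function of the variables [I], whatever the names
   [sg] under which a formula refers to these variables. *)
Definition polyfun (I : Type) (f : (I -> F) -> F) : Prop :=
  forall sg : I -> nat, exists2 t, GRing.rterm t &
    forall e x, (forall i, e`_(sg i) = x i) -> GRing.eval e t = f x.

Lemma polyfun_const (I : Type) c : @polyfun I (fun=> c).
Proof. by move=> sg; exists (GRing.Const c). Qed.

Lemma polyfun_var (I : Type) (i : I) : polyfun (fun x => x i).
Proof. by move=> sg; exists (GRing.Var F (sg i)) => // e x; exact. Qed.

Lemma polyfunD (I : Type) (f g : (I -> F) -> F) :
  polyfun f -> polyfun g -> polyfun (fun x => f x + g x).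
Proof.
move=> pf pg sg; have [t rt tE] := pf sg; have [u ru uE] := pg sg.
exists (GRing.Add t u) => [|e x ex] /=; first by rewrite rt.
by rewrite (tE _ _ ex) (uE _ _ ex).
Qed.

Lemma polyfunM (I : Type) (f g : (I -> F) -> F) :
  polyfun f -> polyfun g -> polyfun (fun x => f x * g x).
Proof.
move=> pf pg sg; have [t rt tE] := pf sg; have [u ru uE] := pg sg.
exists (GRing.Mul t u) => [|e x ex] /=; first by rewrite rt.
by rewrite (tE _ _ ex) (uE _ _ ex).
Qed.

Lemma polyfun_sum (I : Type) (J : Type) (s : seq J) (f : J -> (I -> F) -> F) :
  (forall j, polyfun (f j)) -> polyfun (fun x => \sum_(j <- s) f j x).
Proof.
move=> pf; elim: s => [|j s IHs].
  by under eq_fun do rewrite big_nil; apply: polyfun_const.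
by under eq_fun do rewrite big_cons; apply: polyfunD.
Qed.

Lemma polyfun_reindex (I J : Type) (h : I -> J) (f : (I -> F) -> F) :
  polyfun f -> polyfun (fun x => f (fun i => x (h i))).
Proof.
move=> pf sg; have [t rt tE] := pf (sg \o h).
by exists t => // e x ex; apply: tE => i; apply: ex.
Qed.

(** [GRing.rterm] excludes inverses, so substituting polynomials for the variables of [t] leaves a
    polynomial. *)
Lemma rterm_curve (t : GRing.term F) (ps : seq {poly F}) :
  GRing.rterm t ->
  exists q, forall z, GRing.eval [seq p.[z] | p <- ps] t = q.[z].
Proof.
elim: t => //=.
(* Variables past the end of the list evaluate to 0, as does the default polynomial 0. *)
- move=> i _; exists ps`_i => z; case: (ltnP i (size ps)) => ips.
    by rewrite (nth_map 0).
  by rewrite !nth_default ?size_map // horner0.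
- by move=> c _; exists c%:P => z; rewrite hornerC.
- by move=> n _; exists n%:R%:P => z; rewrite hornerC.
- move=> t IHt u IHu /andP[/IHt[p pE] /IHu[q qE]].
  by exists (p + q) => z; rewrite pE qE hornerD.
- by move=> t IHt /IHt[p pE]; exists (- p) => z; rewrite pE hornerN.
- by move=> t IHt n /IHt[p pE]; exists (p *+ n) => z; rewrite pE hornerMn.
- move=> t IHt u IHu /andP[/IHt[p pE] /IHu[q qE]].
  by exists (p * q) => z; rewrite pE qE hornerM.
- by move=> t IHt n /IHt[p pE]; exists (p ^+ n) => z; rewrite pE horner_exp.
Qed.

Lemma polyfun_curve (I : finType) (f : (I -> F) -> F) (P : I -> {poly F}) :
  polyfun f ->
  exists q : {poly F}, forall z, f (fun i => (P i).[z]) = q.[z].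
Proof.
move=> pf; have [t rt tE] := pf (fun i => enum_rank i).
have [q qE] := rterm_curve [seq P i | i <- enum I] rt.
exists q => z; rewrite -qE; symmetry; apply: tE => i.
by rewrite -map_comp (nth_map i) -?cardE ?ltn_ord // nth_enum_rank.
Qed.

End PolynomialFunctions.

(** * Polynomial maps, their images, and generic truth on them *)

Section PolynomialMaps.
Variables (F : closedFieldType) (T : vectType F).

Local Notation crd k A := (coord (vbasis {:T}) k A).

Definition coords (A : T) : seq F :=
  [seq crd k A | k <- enum 'I_(\dim {:T})].

Lemma size_coords A : size (coords A) = \dim {:T}.
Proof. by rewrite size_map size_enum_ord. Qed.

Lemma nth_coords A (k : 'I_(\dim {:T})) : (coords A)`_k = crd k A.
Proof. by rewrite (nth_map k) ?size_enum_ord // nth_ord_enum. Qed.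

Lemma coord_inj (A B : T) : (forall k, crd k A = crd k B) -> A = B.
Proof.
move=> eAB; rewrite (coord_vbasis (memvf A)) (coord_vbasis (memvf B)).
by apply: eq_bigr => k _; rewrite eAB.
Qed.

Definition polymap (I : Type) (Phi : (I -> F) -> T) : Prop :=
  forall k, polyfun (fun x => crd k (Phi x)).

Definition polycurve (c : F -> T) : Prop :=
  forall k, exists q : {poly F}, forall z, crd k (c z) = q.[z].

Lemma polymap_curve (I : finType) (Phi : (I -> F) -> T) (P : I -> {poly F}) :
  polymap Phi -> polycurve (fun z => Phi (fun i => (P i).[z])).
Proof. by move=> pPhi k; apply: polyfun_curve (pPhi k). Qed.

Lemma polycurveD (c : F -> T) (a : T) :
  polycurve c -> polycurve (fun z => c z + a).
Proof.
move=> pc k; have [q qE] := pc k; exists (q + (crd k a)%:P) => z.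
by rewrite linearD /= qE hornerD hornerC.
Qed.

Lemma rterm_polycurve (t : GRing.term F) (c : F -> T) :
  GRing.rterm t -> polycurve c ->
  exists q, forall z, GRing.eval (coords (c z)) t = q.[z].
Proof.
move=> rt /choice[P PE].
have [q qE] := rterm_curve [seq P k | k <- enum 'I_(\dim {:T})] rt.
exists q => z; rewrite -qE -map_comp; congr GRing.eval.
by apply: eq_map => k /=; rewrite PE.
Qed.

(* The image of a polynomial map is the projection of its graph, hence
   definable by a first-order formula in the coordinates. *)
Lemma image_formula (I : finType) (Phi : (I -> F) -> T) :
  polymap Phi ->
  exists2 f, GRing.rformula f &
    forall A, GRing.holds (coords A) f <-> exists x, A = Phi x.
Proof.
move=> pPhi; set n := \dim {:T}.
(* Variables below [n] name the coordinates of the point; the next [#|I|] name the parameters, to be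
   quantified. *)
pose sg (i : I) := (n + enum_rank i)%N.
have /choice[t tE] : forall k : 'I_n, exists t, GRing.rterm t /\
    forall e x, (forall i, e`_(sg i) = x i) -> GRing.eval e t = crd k (Phi x).
  by move=> k; have [t rt tE] := pPhi k sg; exists t.
pose g k := GRing.Equal (GRing.Var F (nat_of_ord k)) (t k).
pose f := foldr GRing.Exists
  (foldr (fun k => GRing.And (g k)) GRing.True (enum 'I_n)) (iota n #|I|).
exists f.
  rewrite /f; elim: (iota _ _) => //=; elim: (enum _) => //= k s ->.
  by rewrite (tE k).1.
move=> A; rewrite /f -GRing.foldExistsP; split.
  case=> e eA /holds_foldr_And eg; exists (fun i => e`_(sg i)).
  apply: coord_inj => k; have /= := eg k; rewrite mem_enum => /(_ isT).
  rewrite ((tE k).2 e (fun i => e`_(sg i))) // => <-.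
  rewrite -eA ?nth_coords //.
  by rewrite !inE mem_iota negb_and -ltnNge ltn_ord.
case=> x ->; exists (coords (Phi x) ++ [seq x i | i <- enum I]).
  (* Off the quantified variables the two environments agree; past the end both default to 0. *)
  move=> j; rewrite !inE mem_iota negb_and -ltnNge -leqNgt nth_cat size_coords.
  case: ltnP => //= nj; rewrite -/n => lej.
  rewrite [LHS]nth_default ?size_coords // nth_default //.
  by rewrite size_map -cardE leq_subRL.
apply/holds_foldr_And => k _ /=; rewrite nth_cat size_coords ltn_ord.
rewrite nth_coords; symmetry; apply: (tE k).2 => i.
rewrite nth_cat size_coords ltnNge leq_addr /= addKn.
by rewrite (nth_map i) -?cardE ?ltn_ord // nth_enum_rank.
Qed.

(* A weak form of irreducibility; the third point spares us concatenating
   paths. *)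
Definition curve_connected (Y : set T) : Prop :=
  forall p q r, Y p -> Y q -> Y r ->
    exists c w,
      [/\ polycurve c, c 0 = p, c 1 = q, c w = r & forall z, Y (c z)].

Lemma image_curve_connected (I : finType) (Phi : (I -> F) -> T) :
  polymap Phi -> curve_connected (range Phi).
Proof.
move=> pPhi p q r [x _ <-] [y _ <-] [v _ <-].
(* A third parameter [w], other than 0 and 1, at which to pass through the third point. *)
have /(PreClosedField.closed_nonrootP (@solve_monicpoly F))[w] :
    'X * ('X - 1%:P) != 0 :> {poly F}.
  by rewrite mulf_neq0 ?polyX_eq0 ?polyXsubC_eq0.
rewrite rootE hornerM hornerX hornerXsubC => w01.
(* [u] solves [(P i).[w] = v i]: the parameters interpolate [x], [y], [v] quadratically at 0, 1,
   [w]. *)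
pose u i := (v i - x i - w * (y i - x i)) / (w * (w - 1)).
pose P i := (x i)%:P + 'X * (y i - x i)%:P + 'X * ('X - 1%:P) * (u i)%:P.
have PE i z : (P i).[z] = x i + z * (y i - x i) + z * (z - 1) * u i.
  by rewrite /P !(hornerXsubC, hornerD, hornerM, hornerX, hornerC).
exists (fun z => Phi (fun i => (P i).[z])), w; split.
- exact: polymap_curve.
- by congr Phi; apply/funext => i; rewrite PE; ring.
- by congr Phi; apply/funext => i; rewrite PE; ring.
- congr Phi; apply/funext => i; rewrite PE [_ * u i]mulrC divfK //.
  by ring.
- by move=> z; exists (fun i => (P i).[z]).
Qed.

(** The points of [Y] where [t] is nonzero then form a nonempty relatively Zariski-open set. *)
Definition nonvanishing (Y : set T) (t : GRing.term F) : Prop :=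
  GRing.rterm t /\ exists2 p, Y p & GRing.eval (coords p) t != 0.

(** Along a curve in [Y] from a point where [t] is nonzero to one where [u] is, both become nonzero
    polynomials in one variable; their product has a nonroot, the field being infinite. *)
Lemma nonvanishingM (Y : set T) (t u : GRing.term F) :
  curve_connected Y -> nonvanishing Y t -> nonvanishing Y u ->
  nonvanishing Y (GRing.Mul t u).
Proof.
move=> cY [rt [p Yp tp]] [ru [q Yq uq]]; split=> /=; first by rewrite rt.
have [c [_ [pc c0 c1 _ cY']]] := cY _ _ _ Yp Yq Yq.
have [P PE] := rterm_polycurve rt pc; have [Q QE] := rterm_polycurve ru pc.
have P0 : P != 0 by apply: contraNneq tp => P0; rewrite -c0 PE P0 horner0.
have Q0 : Q != 0 by apply: contraNneq uq => Q0; rewrite -c1 QE Q0 horner0.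
have /(PreClosedField.closed_nonrootP (@solve_monicpoly F))[z] : P * Q != 0.
  by rewrite mulf_neq0.
by rewrite rootE hornerM -PE -QE; exists (c z).
Qed.

(** After quantifier elimination, by induction on the formula: an equation holds on all of [Y] or
    fails wherever the difference of its sides is nonzero, and binary connectives multiply the
    terms, by [nonvanishingM]. *)
Lemma generic_truth (Y : set T) (f : GRing.formula F) :
  Y !=set0 -> curve_connected Y -> GRing.rformula f ->
  exists2 t, nonvanishing Y t &
    (forall p, Y p -> GRing.eval (coords p) t != 0 ->
       GRing.holds (coords p) f) \/
    (forall p, Y p -> GRing.eval (coords p) t != 0 ->
       ~ GRing.holds (coords p) f).
Proof.
move=> [y Yy] cY /closed_quantifier_elim[g [qg rg fg]].
suff [t nt tg] : exists2 t, nonvanishing Y t &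
    (forall p, Y p -> GRing.eval (coords p) t != 0 ->
       GRing.holds (coords p) g) \/
    (forall p, Y p -> GRing.eval (coords p) t != 0 ->
       ~ GRing.holds (coords p) g).
  exists t => //; case: tg => tg; [left|right] => p Yp tp.
    by rewrite fg; apply: tg.
  by rewrite fg; apply: tg.
(* The constant 1 serves where no point of [Y] has to be excluded. *)
have n1 : nonvanishing Y (GRing.NatConst F 1).
  by split=> //; exists y => //=; rewrite oner_eq0.
elim: g qg rg {fg f} => //=.
- by move=> b _ _; exists (GRing.NatConst F 1); case: b => //; [left|right].
- move=> t u _ /andP[rt ru].
  have [[p Yp tu]|tu] := pselect (exists2 p, Y p &
      GRing.eval (coords p) t - GRing.eval (coords p) u != 0).
    exists (GRing.Add t (GRing.Opp u)).
      by split; rewrite /= ?rt //; exists p.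
    right=> q Yq /=; apply: contraNnot => /eqP.
    by rewrite subr_eq0.
  exists (GRing.NatConst F 1) => //; left=> p Yp _.
  apply/eqP; rewrite -subr_eq0; apply: contra_notT tu => tu.
  by exists p.
- move=> f IHf g IHg /andP[qf qg] /andP[rf rg].
  have [t nt tE] := IHf qf rf; have [u nu uE] := IHg qg rg.
  exists (GRing.Mul t u); first exact: nonvanishingM.
  case: tE => tE; last first.
    by right=> p Yp /=; rewrite mulf_eq0 => /norP[/(tE _ Yp) tp _] [].
  case: uE => uE; last first.
    by right=> p Yp /=; rewrite mulf_eq0 => /norP[_ /(uE _ Yp) up] [].
  by left=> p Yp /=; rewrite mulf_eq0 => /norP[/(tE _ Yp) ? /(uE _ Yp)].
- move=> f IHf g IHg /andP[qf qg] /andP[rf rg].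
  have [t nt tE] := IHf qf rf; have [u nu uE] := IHg qg rg.
  exists (GRing.Mul t u); first exact: nonvanishingM.
  case: tE => tE.
    by left=> p Yp /=; rewrite mulf_eq0 => /norP[/(tE _ Yp) tp _]; left.
  case: uE => uE.
    by left=> p Yp /=; rewrite mulf_eq0 => /norP[_ /(uE _ Yp) up]; right.
  by right=> p Yp /=; rewrite mulf_eq0 => /norP[/(tE _ Yp) ? /(uE _ Yp) ?] [].
- move=> f IHf g IHg /andP[qf qg] /andP[rf rg].
  have [t nt tE] := IHf qf rf; have [u nu uE] := IHg qg rg.
  exists (GRing.Mul t u); first exact: nonvanishingM.
  case: tE => tE; last first.
    by left=> p Yp /=; rewrite mulf_eq0 => /norP[/(tE _ Yp) tp _] /tp.
  case: uE => uE.
    by left=> p Yp /=; rewrite mulf_eq0 => /norP[_ /(uE _ Yp) up].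
  right=> p Yp /=; rewrite mulf_eq0 => /norP[/(tE _ Yp) tp /(uE _ Yp) up].
  by move=> /(_ tp).
- move=> f IHf qf rf; have [t nt tE] := IHf qf rf.
  exists t => //; case: tE => tE; last by left.
  by right=> p Yp tp; apply; apply: tE.
Qed.

End PolynomialMaps.

(** * Sums of [s] values of a polynomial map *)

Section Secants.
Variables (F : closedFieldType) (T : vectType F) (I : finType).
Variable phi : (I -> F) -> T.
Hypotheses (phi_poly : polymap phi) (phi0 : exists x, phi x = 0).

Definition secant (s : nat) : set T :=
  [set A | exists x : 'I_s -> I -> F, A = \sum_(i < s) phi (x i)].

(** The variables of all summands are gathered in one finite index type, so that the results on
    images of polynomial maps apply. *)
Definition secant_map (s : nat) (x : 'I_s * I -> F) : T :=
  \sum_(i < s) phi (fun j => x (i, j)).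

Lemma secant_map_poly s : polymap (@secant_map s).
Proof.
move=> k; under eq_fun do rewrite linear_sum.
apply: polyfun_sum => i.
exact: (polyfun_reindex (fun j => (i, j)) (phi_poly k)).
Qed.

Lemma secantE s : secant s = range (@secant_map s).
Proof.
apply/seteqP; split=> A /=.
  by case=> x ->; exists (fun ij => x ij.1 ij.2).
by case=> x _ <-; exists (fun i j => x (i, j)).
Qed.

Lemma secant_curve_connected s : curve_connected (secant s).
Proof.
by rewrite secantE; apply: image_curve_connected; apply: secant_map_poly.
Qed.

Lemma secantD s u A B : secant s A -> secant u B -> secant (s + u) (A + B).
Proof.
move=> [x ->] [y ->].
exists (fun i : 'I_(s + u) =>
  match fintype.split i with inl j => x j | inr j => y j end).
rewrite big_split_ord /=; congr (_ + _); apply: eq_bigr => i _.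
  by rewrite (unsplitK (inl i)).
by rewrite (unsplitK (inr i)).
Qed.

Lemma secant_split s u A : secant (s + u) A ->
  exists B C, [/\ secant s B, secant u C & A = B + C].
Proof.
move=> [x ->]; rewrite big_split_ord /=.
exists (\sum_(i < s) phi (x (lshift u i))).
exists (\sum_(i < u) phi (x (rshift s i))); split=> //.
  by exists (fun i => x (lshift u i)).
by exists (fun i => x (rshift s i)).
Qed.

Lemma secant0 s : secant s 0.
Proof.
have [x0 px0] := phi0; exists (fun=> x0).
by rewrite big1 // => i _.
Qed.

Lemma secant_le s u : (s <= u)%N -> secant s `<=` secant u.
Proof.
move=> su A sA; rewrite -(subnKC su) -(addr0 A).
exact: secantD (secant0 _).
Qed.

(* An instance of Chevalley's theorem on constructible sets. *)
Lemma secant_dichotomy s g :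
  (exists2 t, nonvanishing (secant g) t &
     forall A, secant g A -> GRing.eval (coords A) t != 0 -> secant s A) \/
  (exists2 t, nonvanishing (secant g) t &
     forall A, secant g A -> secant s A -> GRing.eval (coords A) t = 0).
Proof.
have [f rf fE] := image_formula (@secant_map_poly s).
have secE A : GRing.holds (coords A) f <-> secant s A.
  rewrite fE secantE; split=> [[x ->]|[x _ <-]]; last by exists x.
  by exists x.
have [t nt tE] := generic_truth (ex_intro _ _ (secant0 g))
  (@secant_curve_connected g) rf.
case: tE => tE; [left|right]; exists t => // A gA.
  by move=> tA; rewrite -secE; apply: tE.
by rewrite -secE => hA; apply/eqP; apply: contraPT (tE A gA) hA.
Qed.

(* Take [n] least such that the equation [t] of [secant s] does not vanish on
   [secant n]: translating [t] by a sum of [n - s.+1] terms gives an equation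
   of [secant s] which is not one of [secant s.+1]. *)
Lemma secant_separation s g t :
  nonvanishing (secant g) t ->
  (forall A, secant s A -> GRing.eval (coords A) t = 0) ->
  exists2 a, (exists2 p, secant s.+1 p & GRing.eval (coords (p + a)) t != 0) &
    forall A, secant s A -> GRing.eval (coords (A + a)) t = 0.
Proof.
move=> [rt tg] ts.
pose P n := `[< exists2 p, secant n p & GRing.eval (coords p) t != 0 >].
have exP : exists n, P n by exists g; apply/asboolP.
have [n /asboolP[p np tp] minn] := ex_minnP exP.
have sn : (s < n)%N.
  rewrite ltnNge; apply/negP => ns.
  by move: tp; rewrite ts ?eqxx //; apply: secant_le ns _ np.
move: np; rewrite -(subnKC sn) => /secant_split[q [a [sq ua pE]]].
exists a; first by exists q; rewrite -?pE.
move=> A sA; apply/eqP; apply/negP => /negP tA.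
(* Otherwise [A + a], a sum of [s + (n - s.+1) = n - 1] terms, would contradict the minimality of
   [n]. *)
have : (n <= s + (n - s.+1))%N.
  by apply: minn; apply/asboolP; exists (A + a) => //; apply: secantD.
by rewrite leqNgt -addSn subnKC // leqnn.
Qed.

End Secants.

(** * Continuity and density in the Euclidean topology *)

Lemma num_continuous_horner (K : numFieldType) (p : {poly K}) :
  continuous (fun z : K => p.[z]).
Proof.
elim/poly_ind: p => [|p c IHp] z.
  by under eq_fun do rewrite horner0; apply: cst_continuous.
rewrite (_ : (fun z => _) = (fun z => p.[z]) \* id \+ cst c); last first.
  by apply/funext => y; rewrite hornerMXaddC.
apply: continuousD; last exact: cst_continuous.
by apply: continuousM; [exact: IHp|exact: cvg_id].
Qed.

Lemma continuous_rowP (X Y : topologicalType) (n : nat) (f : X -> 'rV[Y]_n) :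
  (forall k, continuous (fun x => f x 0 k)) -> continuous f.
Proof.
move=> cf x U [P nP sPU].
have fP : \forall y \near x, forall k, P 0 k (f y 0 k).
  by apply: filter_forall => k; apply: (cf k x); apply: nP.
by apply: filterS fP => y Py; apply: sPU => i k; rewrite (ord1 i).
Qed.

Lemma nonroot_near (K : numFieldType) (p : {poly K}) (z : K) (U : set K) :
  p != 0 -> nbhs z U -> exists2 y, U y & p.[y] != 0.
Proof.
move=> p0 /nbhs_ballP[e /= e0 eU].
(* These are [size p] distinct points, one more than the degree; [i.+2] keeps their distance to [z]
   strictly below [e]. *)
pose y (i : 'I_(size p)) := z + e / i.+2%:R.
have yU i : U (y i).
  apply: eU; rewrite -ball_normE /= /y opprD addrA subrr add0r normrN.
  rewrite gtr0_norm ?divr_gt0 ?ltr0n // ltr_pdivrMr ?ltr0n //.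
  by rewrite ltr_pMr // ltr1n.
have [//|ry] := pselect (exists2 y, U y & p.[y] != 0).
have := @max_poly_roots _ _ [seq y i | i <- enum 'I_(size p)] p0.
rewrite size_map size_enum_ord ltnn => maxp.
suff : false by []; apply: maxp.
  apply/allP => _ /mapP[i _ ->]; apply: contra_notT ry => ry.
  by exists (y i).
rewrite map_inj_uniq ?enum_uniq // => i j /addrI.
move=> /(mulfI (lt0r_neq0 e0)) /invr_inj /eqP.
by rewrite eqr_nat => /eqP [] /val_inj.
Qed.

Section EuclideanTopology.
Variable R : realType.
Local Notation C := (R[i] : numFieldType).

Lemma continuous_real_complex : continuous (fun t : R => t%:C : C).
Proof.
move=> t; apply/cvgrPdist_lt => e e0.
(* The radius [e] is a complex number; being positive, it is real. *)
have eR : (complex.Re e)%:C = e by rewrite RRe_real // gtr0_real.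
have {}e0 : 0 < complex.Re e by rewrite -ltcR eR.
have := @cvg_id _ (nbhs t) => /cvgrPdist_lt /(_ _ e0).
apply: filterS => s st.
rewrite -eR -rmorphB /= normc_def /= expr0n /= addr0 sqrtr_sqr.
by rewrite ltcR.
Qed.

(* The path bends off the segment [0, 1] at a height avoiding the finitely
   many roots. *)
Lemma path_avoiding_roots (q : {poly C}) : q != 0 ->
  exists z : R -> C, [/\ continuous z, z 0 = 0, z 1 = 1 &
    forall t, 0 < t < 1 -> q.[z t] != 0].
Proof.
move=> q0; have [rs qE] := closed_field_poly_normal (q : {poly R[i]}).
(* A root [x] on the path would make this quotient equal to [h]. Where [Re x] is 0 or 1 the quotient
   is 0 by convention, harmlessly: for [0 < t < 1] the path has real part [t]. *)
have [h hP] : exists h : R, forall x, x \in rs ->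
    complex.Im x / (complex.Re x * (1 - complex.Re x)) < h.
  elim: rs {qE} => [|x s [h hs]]; first by exists 0.
  exists (Num.max h (complex.Im x / (complex.Re x * (1 - complex.Re x)) + 1)).
  move=> y; rewrite inE lt_max => /predU1P[->|/hs->//].
  by rewrite ltrDl ltr01 orbT.
pose b : {poly C} := 'X + ('i * h%:C)%:P * ('X * (1%:P - 'X)).
have bE t : b.[t%:C] = t +i* (h * (t * (1 - t))).
  rewrite !(hornerD, hornerN, hornerM, hornerX, hornerC).
  by apply/eqP; rewrite eq_complex /=; simpc.
exists (fun t => b.[t%:C]); split.
- move=> t; apply: continuous_comp; first exact: continuous_real_complex.
  exact: num_continuous_horner.
- by rewrite bE mul0r mulr0.
- by rewrite bE subrr !mulr0.
move=> t /andP[t0 t1].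
rewrite qE hornerZ mulf_neq0 ?lead_coef_eq0 //.
rewrite horner_prod prodf_seq_neq0; apply/allP => x xrs /=.
rewrite hornerXsubC subr_eq0; apply: contraTneq (hP x xrs) => <-.
by rewrite bE /= mulfK ?ltxx // mulf_neq0 ?gt_eqF ?subr_gt0.
Qed.

Variable T : vectType R[i].

Lemma polycurve_continuous (c : C -> euclidean T) :
  @polycurve R[i] T c -> continuous c.
Proof.
move=> pc; apply: continuous_comp_initial; apply: continuous_rowP => k.
have [q qE] := pc k.
rewrite (_ : (fun z => _) = (fun z : C => q.[z])); last first.
  by apply/funext => z; rewrite /= mxE qE.
exact: num_continuous_horner.
Qed.

(** Along a curve in [Y] from [A] to a point where [t] is nonzero, [t] is a nonzero polynomial; it
    has nonroots arbitrarily close to the parameter of [A]. *)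
Lemma nonvanishing_dense (Y : set T) (t : GRing.term R[i]) :
  curve_connected Y -> nonvanishing Y t ->
  Y `<=` closure ([set A | Y A /\ GRing.eval (coords A) t != 0]
                   : set (euclidean T)).
Proof.
move=> cY [rt [p Yp tp]] A YA U nU.
have [c [w [pc c0 c1 _ cY']]] := cY _ _ _ YA Yp Yp.
have [q qE] := rterm_polycurve rt pc.
have q0 : q != 0 by apply: contraNneq tp => q0; rewrite -c1 qE q0 horner0.
have cU : nbhs (0 : C) (c @^-1` U).
  by apply: (@polycurve_continuous c pc 0); rewrite c0.
have [z Uz qz] := nonroot_near q0 cU.
by exists (c z); split=> //; split; rewrite // qE.
Qed.

(** * Paths in the difference of successive secant sets *)

Section SecantPaths.
Variables (I : finType) (phi : (I -> R[i]) -> T).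
Hypotheses (phi_poly : polymap phi) (phi0 : exists x, phi x = 0).

(** Phrasing the minimality of [g] by closures equal to that of [secant phi g] fits both the whole
    tensor space and the symmetric subspace. *)
Lemma secant_equation (s g : nat) :
  (forall u, closure (secant phi u : set (euclidean T)) =
             closure (secant phi g : set (euclidean T)) -> (g <= u)%N) ->
  (s < g)%N ->
  exists t a, [/\ GRing.rterm t,
    exists2 p, secant phi s.+1 p & GRing.eval (coords (p + a)) t != 0 &
    forall A, secant phi s A -> GRing.eval (coords (A + a)) t = 0].
Proof.
move=> ming sg; have sgP := secant_le phi0 (ltnW sg).
case: (secant_dichotomy phi_poly phi0 s g) => -[t nt tE].
  suff /ming : closure (secant phi s : set (euclidean T)) =
               closure (secant phi g : set (euclidean T)).
    by rewrite leqNgt sg.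
  apply/seteqP; split; first exact: closureS.
  (* As closure is idempotent, it suffices to put [secant phi g] in the closure of
     [secant phi s]. *)
  have <- : closure (closure (secant phi s : set (euclidean T))) =
            closure (secant phi s : set (euclidean T)).
    by symmetry; apply/closure_id/closed_closure.
  have dn := nonvanishing_dense (@secant_curve_connected _ _ _ _ phi_poly g) nt.
  apply: closureS => A /dn.
  by apply: closureS => {}A [gA tA]; apply: tE.
have [a ap as0] := secant_separation phi0 nt (fun A sA => tE A (sgP A sA) sA).
by exists t, a; split=> //; case: nt.
Qed.

Lemma secant_path_connected (r g : nat) :
  (forall u, closure (secant phi u : set (euclidean T)) =
             closure (secant phi g : set (euclidean T)) -> (g <= u)%N) ->
  (r < g)%N ->
  path_connected R (secant phi r.+1 `\` secant phi r : set (euclidean T)).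
Proof.
move=> ming rg; have [t [a [rt [p rp tp] tr]]] := secant_equation ming rg.
split.
  by exists p; split=> // /tr /eqP; rewrite (negPf tp).
move=> x y [rx nx] [ry ny].
(* Passing through [p] ensures that the polynomial is not identically zero along the curve. *)
have [c [w [pc c0 c1 cw cr]]] :=
  secant_curve_connected phi_poly rx ry rp.
have [q qE] := rterm_polycurve rt (polycurveD a pc).
have q0 : q != 0 by apply: contraNneq tp => q0; rewrite -cw qE q0 horner0.
have [z [cz z0 z1 qz]] := path_avoiding_roots q0.
exists (c \o z); split; rewrite /= ?z0 ?z1 //.
  apply: continuous_subspaceT => u; apply: continuous_comp; first exact: cz.
  exact: polycurve_continuous.
move=> u; rewrite in_itv /= => /andP[u0 u1]; split; first exact: cr.
(* At the ends the polynomial may vanish; [nx] and [ny] apply there. *)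
have [u00|un0] := eqVneq u 0; first by rewrite u00 z0 c0.
have [u11|un1] := eqVneq u 1; first by rewrite u11 z1 c1.
move=> /tr /eqP; rewrite qE; apply/negP; apply: qz.
by rewrite !lt_neqAle eq_sym un0 u0 un1 u1.
Qed.

End SecantPaths.
End EuclideanTopology.

(** * Polynomial parametrizations of decomposable tensors and of powers *)

Lemma linear_scaled_sum (F : fieldType) (U V : lmodType F) (f : U -> V)
    (I : Type) (s : seq I) (a : I -> F) (u : I -> U) :
  linear f -> f (\sum_(i <- s) a i *: u i) = \sum_(i <- s) a i *: f (u i).
Proof.
move=> lf; elim: s => [|i s IHs]; last by rewrite !big_cons lf IHs.
(* [f 0 = 0] follows from linearity applied to [0 = -1 *: 0 + 0]. *)
by rewrite !big_nil -[X in f X](addNr 0) -scaleN1r lf scaleN1r addNr.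
Qed.

Lemma dfwithE (I : eqType) (V : Type) (w : I -> V) (j : I) (v : V) (i : I) :
  dfwith (T := fun=> V) w j v i = if i == j then v else w i.
Proof.
case: (eqVneq i j) => [->|ij]; first by rewrite dfwithin.
by rewrite dfwithout // eq_sym.
Qed.

Section Tensors.
Variables (F : closedFieldType) (d : nat).

Section Decomposable.
Variables (W : 'I_d -> vectType F) (T : vectType F).
Variable tau : (forall j, W j) -> T.
Hypothesis tau_mul : multilinear tau.

Definition tensor_vars := {j : 'I_d & 'I_(\dim {:W j})}.

Definition vectors_of (x : tensor_vars -> F) (j : 'I_d) : W j :=
  \sum_(k < \dim {:W j}) x (Tagged (fun j => 'I_(\dim {:W j})) k) *:
    (vbasis {:W j})`_k.

Lemma vectors_of_surj (w : forall j, W j) : exists x, vectors_of x = w.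
Proof.
exists (fun t => coord (vbasis {:W (tag t)}) (tagged t) (w (tag t))).
by apply: functional_extensionality_dep => j; apply/esym/coord_vbasis/memvf.
Qed.

(* The slots are expanded along the bases one at a time. *)
Lemma tensor_polymap : polymap (fun x => tau (vectors_of x)).
Proof.
(* The slots in [s] carry variables, the others fixed vectors [w]; [w] is kept general because
   expanding slot [j] puts basis vectors there. *)
have expand (s : seq 'I_d) (w : forall j, W j) :
    polymap (fun x => tau (fun j => if j \in s then vectors_of x j else w j)).
  elim: s w => [|j s IHs] w k /=; first exact: polyfun_const.
  (* A slot occurring again in [s] is already expanded. *)
  case js: (j \in s).
    under eq_fun => x.
      rewrite (_ : (fun i => _) =
        (fun i => if i \in s then vectors_of x i else w i)).
      over.
      apply: functional_extensionality_dep => i; rewrite inE.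
      by case: eqP => [->|//]; rewrite js.
    exact: IHs.
  rewrite (_ : (fun x => _) = (fun x => \sum_(l < \dim {:W j})
      x (Tagged (fun j => 'I_(\dim {:W j})) l) *
      coord (vbasis {:T}) k (tau (fun i => if i \in s then vectors_of x i
         else dfwith w j (vbasis {:W j})`_l i)))).
    apply: polyfun_sum => l; apply: polyfunM; first exact: polyfun_var.
    exact: IHs.
  apply/funext => x.
  pose v i := if i \in s then vectors_of x i else w i.
  have vE (u : W j) : (fun i => if i \in s then vectors_of x i
      else dfwith w j u i) = dfwith v j u.
    apply: functional_extensionality_dep => i.
    case: dfwithP => [|i' ji]; first by rewrite js dfwithin.
    by rewrite /v dfwithout.
  rewrite (_ : (fun i => _) = dfwith v j (vectors_of x j)); last first.
    apply: functional_extensionality_dep => i; rewrite inE.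
    case: dfwithP => [|i' ji]; first by rewrite eqxx.
    by rewrite eq_sym (negPf ji).
  have -> : tau (dfwith v j (vectors_of x j)) = \sum_(l < \dim {:W j})
      x (Tagged (fun j => 'I_(\dim {:W j})) l) *:
        tau (dfwith v j (vbasis {:W j})`_l).
    exact: (@linear_scaled_sum _ _ _ _ _ _ _ _ (@tau_mul v j)).
  rewrite linear_sum.
  by apply: eq_bigr => l _; rewrite linearZ vE.
move=> k; have := expand (enum 'I_d) (fun j => 0) k.
congr polyfun; apply/funext => x; congr (coord _ _ (tau _)).
by apply: functional_extensionality_dep => j; rewrite mem_enum.
Qed.

Lemma tensor0 (j : 'I_d) (w : forall j, W j) : w j = 0 -> tau w = 0.
Proof.
move=> wj0.
have -> : w = dfwith w j 0.
  apply: functional_extensionality_dep => i.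
  by case: dfwithP.
have := @linear_scaled_sum F _ _ _ nat [::] (fun=> 0) (fun=> 0) (@tau_mul w j).
by rewrite !big_nil.
Qed.

Lemma secant_tensor s :
  secant (fun x => tau (vectors_of x)) s =
  [set A | exists v : 'I_s -> forall j, W j, A = \sum_(i < s) tau (v i)].
Proof.
apply/seteqP; split=> A [v ->]; first by exists (fun i => vectors_of (v i)).
have /choice[x xE] := fun i => vectors_of_surj (v i).
by exists x; apply: eq_bigr => i _; rewrite xE.
Qed.

End Decomposable.

Section Symmetric.
Variables (W T : vectType F) (tau : ('I_d -> W) -> T).
Hypothesis tau_tensor : is_tensor_product (W := fun=> W) tau.

Definition vector_of (x : 'I_(\dim {:W}) -> F) : W :=
  \sum_(k < \dim {:W}) x k *: (vbasis {:W})`_k.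

(** The parametrization of decomposable tensors, with all slots made to read the same variables. *)
Lemma symtensor_polymap : polymap (fun x => tau (fun=> vector_of x)).
Proof.
move=> k.
exact: (polyfun_reindex (fun t : tensor_vars (fun=> W) => tagged t)
  (tensor_polymap (proj1 tau_tensor) k)).
Qed.

Lemma secant_symtensor s :
  secant (fun x => tau (fun=> vector_of x)) s =
  [set A | exists v : 'I_s -> W, A = \sum_(i < s) tau (fun=> v i)].
Proof.
apply/seteqP; split=> A [v ->]; first by exists (fun i => vector_of (v i)).
exists (fun i k => coord (vbasis {:W}) k (v i)).
apply: eq_bigr => i _; congr tau; apply/funext => _.
exact/coord_vbasis/memvf.
Qed.

(** A change in slot [j] shows at position [s^-1 j] of the permuted family, where [tau] is
    linear. *)
Lemma multilinear_perm (s : 'S_d) :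
  multilinear (W := fun=> W) (fun w : 'I_d -> W => tau (fun j => w (s j))).
Proof.
move=> w j a u v.
have permE x : (fun i => dfwith (T := fun=> W) w j x (s i)) =
    dfwith (T := fun=> W) (fun i => w (s i)) ((s^-1)%g j) x.
  apply/funext => i; rewrite !dfwithE.
  by rewrite -[in RHS](inj_eq (@perm_inj _ s)) permKV.
rewrite !permE; exact: (proj1 tau_tensor).
Qed.

(** The universal property turns [multilinear_perm] into an endomorphism permuting the slots, which
    fixes every power. *)
Lemma power_sum_symmetric s :
  secant (fun x => tau (fun=> vector_of x)) s `<=` symmetric_tensors tau.
Proof.
move=> A [x ->] p.
have [f [fE _]] := proj2 tau_tensor _ _ (multilinear_perm p).
exists f; split=> //; rewrite linear_sum.
by apply: eq_bigr => i _ /=; rewrite fE.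
Qed.

End Symmetric.
End Tensors.

(** * Ranks as least numbers, and the conclusion *)

Lemma is_least_upward (P : nat -> Prop) (s : nat) :
  {homo P : m n / (m <= n)%N >-> m -> n} ->
  (is_least P s.+1 <-> P s.+1 /\ ~ P s).
Proof.
move=> mP; split=> [[Ps lP]|[Ps nP]].
  by split=> // /lP; rewrite ltnn.
by split=> // u Pu; rewrite ltnNge; apply/negP => us; apply: nP; apply: mP Pu.
Qed.

Lemma exists_least_le (P : nat -> Prop) (s : nat) :
  {homo P : m n / (m <= n)%N >-> m -> n} ->
  ((exists2 u, (u <= s)%N & is_least P u) <-> P s).
Proof.
move=> mP; split=> [[u us [Pu _]]|Ps]; first exact: mP us Pu.
have exP : exists u, `[< P u >] by exists s; apply/asboolP.
have [u /asboolP Pu lu] := ex_minnP exP.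
exists u; first by apply: lu; apply/asboolP.
by split=> // v Pv; apply: lu; apply/asboolP.
Qed.

Theorem corollary3p8 (R : realType) (d r : nat) (d_gt0 : (0 < d)%N)
    (r_gt0 : (0 < r)%N) :
  (forall (W : 'I_d -> vectType R[i]) (T : vectType R[i])
      (tau : (forall j, W j) -> T) (g : nat),
    (forall j, (2 <= \dim {:W j})%N) ->
    is_tensor_product tau ->
    is_generic_rank tau g -> (r <= g)%N ->
    path_connected R (rank_eq_set tau r : set (euclidean T)))
  /\
  (forall (W T : vectType R[i]) (tau : ('I_d -> W) -> T) (g : nat),
    (2 <= \dim {:W})%N ->
    is_tensor_product (W := fun=> W) tau ->
    is_generic_symrank tau g -> (r <= g)%N ->
    path_connected R (symrank_eq_set tau r : set (euclidean T))).
Proof.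
case: r r_gt0 => // r _; split=> W T tau g _ tauT [clg ming] rg.
- pose phi := fun x => tau (vectors_of x).
  have phi_poly : polymap phi := tensor_polymap (proj1 tauT).
  have phi0 : exists x, phi x = 0.
    (* As [d] is positive there is a slot, and a zero vector in it makes the tensor 0; this pads
       shorter sums. *)
    have [x xE] := vectors_of_surj (fun j => 0 : W j).
    by exists x; rewrite /phi xE (tensor0 (proj1 tauT) (j := Ordinal d_gt0)).
  have rankE A s : is_rank tau A s = is_least (fun u => secant phi u A) s.
    by congr is_least; apply/funext => u; rewrite secant_tensor.
  have homo A : {homo (fun s => secant phi s A) : s u / (s <= u)%N >-> s -> u}.
    by move=> s u su; apply: (secant_le phi0 su).
  have leE s : rank_le_set tau s = secant phi s.
    apply/funext => A; apply/propext; rewrite -(exists_least_le _ (homo A)).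
    by split=> -[u us uA]; exists u => //; [rewrite -rankE|rewrite rankE].
  (* Sums of [s] terms being also sums of more, rank [r.+1] means being a sum of [r.+1] terms but
     not of [r]. *)
  have -> : rank_eq_set tau r.+1 = secant phi r.+1 `\` secant phi r.
    apply/funext => A; apply/propext; rewrite /rank_eq_set /= rankE.
    exact: is_least_upward (homo A).
  rewrite leE in clg.
  (* By [clg], having the same closure as [secant phi g] means being dense, so the minimality of the
     generic rank applies. *)
  apply: (secant_path_connected phi_poly phi0 _ rg) => u; rewrite clg => clu.
  by apply: ming; rewrite leE.
- pose phi := fun x : 'I_(\dim {:W}) -> R[i] => tau (fun=> vector_of x).
  have phi_poly : polymap phi := symtensor_polymap tauT.
  have phi0 : exists x, phi x = 0.
    exists (fun=> 0); apply: (tensor0 (proj1 tauT) (j := Ordinal d_gt0)).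
    by rewrite /vector_of big1 // => k _; rewrite scale0r.
  have rankE A s : is_symrank tau A s = is_least (fun u => secant phi u A) s.
    by congr is_least; apply/funext => u; rewrite secant_symtensor.
  have homo A : {homo (fun s => secant phi s A) : s u / (s <= u)%N >-> s -> u}.
    by move=> s u su; apply: (secant_le phi0 su).
  have leE s : symrank_le_set tau s = secant phi s.
    apply/funext => A; apply/propext; rewrite -(exists_least_le _ (homo A)).
    split=> [[_ [u us uA]]|[u us uA]].
      by exists u => //; rewrite -rankE.
    split; last by exists u => //; rewrite rankE.
    (* Symmetry comes from the expression of [A] as a sum of powers. *)
    by apply: (power_sum_symmetric tauT); case: uA => + _; apply.
  have -> : symrank_eq_set tau r.+1 = secant phi r.+1 `\` secant phi r.
    apply/funext => A; apply/propext; rewrite /symrank_eq_set /= rankE.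
    rewrite (is_least_upward _ (homo A)); split=> [[]//|rA]; split=> //.
    by case: rA => + _; apply: (power_sum_symmetric tauT).
  rewrite leE in clg.
  apply: (secant_path_connected phi_poly phi0 _ rg) => u; rewrite clg => clu.
  by apply: ming; rewrite leE.
Qed.
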